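(* Let $n$ be a positive integer, let $G=(V,E)$ be a partial order of the $n$ binary variables $x_1,\dots,x_n$, and let $\phi: B_n\to\mathbb{R}$, $\phi(x)=x^\top Q x$, be a quadratic function with $Q\in \mathbb{R}^{n\times n}$. For $i,j=1,2,\dots,n$, define $$a_{i,j} := \begin{cases} Q_{i,j} + Q_{j,i} & i \ne j, \\ Q_{i,i} & i=j. \end{cases}$$ If the inequality $$S_{i,j} := \sum_{\substack{k=1 \\ k\ne i,j}}^n \max \{ 0, a_{j,k} - a_{i,k} \} + a_{j,j} - a_{i,i} \le 0$$ holds for every directed edge $(x_i,x_j)\in E$, then $G$ is valid with respect to minimization of $\phi$.
   Context: $B_n := \{0,1\}^n$. A partial order of $n$ binary variables $x=(x_1,\dots,x_n)$ is a directed acyclic graph $G=(V,E)$ with vertex set $V=\{x_1,\dots,x_n\}$ and edge set $E\subset V\times V$. Here, as vertices, $x_1,\dots,x_n$ are just symbols (equivalently, the indices $1,\dots,n$), while for a vector $x\in B_n$, $x_i\in\{0,1\}$ denotes its $i$-th entry. The subset of $B_n$ ordered by $G$ is $$B_n^G := \{ x\in B_n \mid \forall (x_i, x_j)\in E,\ x_i=1 \Rightarrow x_j=1 \}.$$ The partial order $G$ is valid with respect to minimization of $\phi: B_n\to\mathbb{R}$ if $\min\{\phi(x) \mid x \in B_n\} = \min\{\phi(x) \mid x \in B_n^G\}$. Note that $G$ is only required to be a directed acyclic graph (no transitivity of $E$ is required). *)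

(* Defs.v *)
From HB Require Import structures.
From mathcomp Require Import all_boot all_order all_algebra.
From mathcomp Require Import reals.

Set Implicit Arguments.
Unset Strict Implicit.
Unset Printing Implicit Defensive.

Import Order.TTheory GRing.Theory Num.Theory.
Local Open Scope ring_scope.

(* Binary vectors are boolean columns: the entry x_i is [x i 0]. *)
Definition binvec (n : nat) := 'cV[bool]_n.

(* No nonempty directed closed walk; in particular, no loops. *)
Definition acyclic (T : eqType) (E : rel T) : Prop :=
  forall c : seq T, cycle E c -> c = [::].

Definition ordered_by (n : nat) (E : rel 'I_n) : {set binvec n} :=
  [set x : binvec n | [forall i, forall j, E i j ==> (x i 0 ==> x j 0)]].

Definition zero_binvec (n : nat) : binvec n := const_mx false.

Lemma zero_binvec_ordered_by (n : nat) (E : rel 'I_n) :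
  zero_binvec n \in ordered_by E.
Proof.
by rewrite inE; apply/forallP => i; apply/forallP => j; rewrite !mxE implybT.
Qed.

(* The minimum of phi over A. The zero vector is the witness of nonemptiness
   that [arg min] asks for: it belongs to B_n and to every B_n^G, so both
   uses of [min_over] in [valid_order] are genuine minima (min_overP). *)
Definition min_over (R : realType) (n : nat) (phi : binvec n -> R)
    (A : {set binvec n}) : R :=
  phi [arg min_(x < zero_binvec n in A) phi x]%O.

Lemma min_overP (R : realType) (n : nat) (phi : binvec n -> R)
    (A : {set binvec n}) :
  zero_binvec n \in A ->
  (exists2 x, x \in A & phi x = min_over phi A) /\
  (forall y, y \in A -> min_over phi A <= phi y).
Proof.
move=> A0; rewrite /min_over; case: arg_minP => // x xA xmin.
by split; [exists x | exact: xmin].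
Qed.

Definition valid_order (R : realType) (n : nat) (E : rel 'I_n)
    (phi : binvec n -> R) : Prop :=
  min_over phi [set: binvec n] = min_over phi (ordered_by E).

Definition real_vec (R : realType) (n : nat) (x : binvec n) : 'cV[R]_n :=
  map_mx (fun b : bool => b%:R) x.

Definition quad_form (R : realType) (n : nat) (Q : 'M[R]_n)
    (x : binvec n) : R :=
  ((real_vec R x)^T *m Q *m real_vec R x) 0 0.

Definition pair_coef (R : realType) (n : nat) (Q : 'M[R]_n) (i j : 'I_n) : R :=
  if i == j then Q i i else Q i j + Q j i.

Definition edge_bound (R : realType) (n : nat) (Q : 'M[R]_n)
    (i j : 'I_n) : R :=
  (\sum_(k < n | (k != i) && (k != j))
      Num.max 0 (pair_coef Q j k - pair_coef Q i k))
  + pair_coef Q j j - pair_coef Q i i.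

(* Main.v *)
(* If a minimizer x violates an edge (i, j), that is x_i = 1 and x_j = 0, then
   moving the 1 from i to j changes phi by
     a_jj - a_ii + sum_(k <> i, j) (a_jk - a_ik) x_k <= S_ij <= 0,
   so the new vector is again a minimizer. As E is acyclic, the number of
   ancestors strictly increases along edges, hence so does the total number of
   ancestors over the support of x. A minimizer maximizing this total
   therefore violates no edge. *)
Require Import Defs.
From mathcomp Require Import all_boot all_order all_algebra.
From mathcomp Require Import reals.
From mathcomp Require Import ring.

Set Implicit Arguments.
Unset Strict Implicit.
Unset Printing Implicit Defensive.

Import Order.TTheory GRing.Theory Num.Theory.
Local Open Scope ring_scope.

Lemma acyclic_edge_connectF (T : finType) (E : rel T) (i j : T) :
  acyclic E -> E i j -> connect E j i = false.
Proof.
move=> acE Eij; apply/negP => /connectP[p Ep ip].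
(* The edge from [i] closes the path from [j]; an empty [p] means [i = j], and then the cycle is a
   loop. *)
suff /acE : cycle E (j :: p) by [].
by rewrite /= rcons_path Ep -ip.
Qed.

(** Ancestors of [i] are ancestors of [j] by transitivity. Since [connect] is reflexive, [j] counts
    itself, and by acyclicity it is no ancestor of [i]. *)
Lemma acyclic_ltn_ancestors (T : finType) (E : rel T) (i j : T) :
  acyclic E -> E i j ->
  (#|[set k | connect E k i]| < #|[set k | connect E k j]|)%N.
Proof.
move=> acE Eij; apply: proper_card; apply/properP; split.
  apply/subsetP => k; rewrite !inE => /connect_trans; apply.
  exact: connect1.
by exists j; rewrite inE ?connect0 // acyclic_edge_connectF.
Qed.

Definition move_one (n : nat) (i j : 'I_n) (x : binvec n) : binvec n :=
  \col_k ((k == j) || (k != i) && x k 0).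

Lemma ltn_sum_move_one (n : nat) (r : 'I_n -> nat) (i j : 'I_n)
    (x : binvec n) : x i 0 -> ~~ x j 0 -> (r i < r j)%N ->
  (\sum_(k | x k 0%R) r k < \sum_(k | move_one i j x k 0%R) r k)%N.
Proof.
move=> xi xj rij; rewrite (bigD1 i) //= [ltnRHS](bigD1 j) /= ?mxE ?eqxx //.
(* Once [i] is split off the old support and [j] off the new one, the same indices remain. *)
rewrite (eq_bigl (fun k => move_one i j x k 0 && (k != j))) ?ltn_add2r // => k.
rewrite mxE; case: (eqVneq k j) => [->|_] /=; first by rewrite (negbTE xj).
by rewrite andbT andbC.
Qed.

Lemma real_vec_move_one (R : realType) (n : nat) (i j : 'I_n) (x : binvec n) :
  x i 0 -> ~~ x j 0 ->
  real_vec R (move_one i j x) = real_vec R x + (delta_mx j 0 - delta_mx i 0).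
Proof.
move=> xi xj; apply/matrixP => k l; rewrite !mxE ord1 eqxx !andbT.
case: (eqVneq k j) => [->|_].
  case: (eqVneq j i) => [ji|_]; first by rewrite ji xi in xj.
  by rewrite (negbTE xj) add0r subr0.
case: (eqVneq k i) => [->|_]; first by rewrite xi sub0r subrr.
by rewrite sub0r oppr0 addr0.
Qed.

(** With $d = e_j - e_i$, the sum is the cross term $d^T Q u + u^T Q d$ and the last bracket is $d^T
    Q d$. *)
Lemma mulmx_quad_shift (R : comPzRingType) (n : nat) (Q : 'M[R]_n)
    (u : 'cV[R]_n) (i j : 'I_n) :
  let v := u + (delta_mx j 0 - delta_mx i 0) in
  (v^T *m Q *m v) 0 0 = (u^T *m Q *m u) 0 0
    + \sum_k (Q j k + Q k j - (Q i k + Q k i)) * u k 0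
    + (Q i i + Q j j - Q i j - Q j i).
Proof.
rewrite /= [(u + _)^T]linearD /= [(_ - _)^T]linearB /= !trmx_delta.
rewrite !mulmxDl !mulNmx -!rowE !mulmxDr !mulmxN -!colE.
have rowM (l : 'I_n) : (row l Q *m u) 0 0 = \sum_k Q l k * u k 0.
  by rewrite mxE; apply: eq_bigr => k _; rewrite mxE.
have colM (l : 'I_n) : (col l (u^T *m Q)) 0 0 = \sum_k Q k l * u k 0.
  by rewrite !mxE; apply: eq_bigr => k _; rewrite mxE mulrC.
have -> : \sum_k (Q j k + Q k j - (Q i k + Q k i)) * u k 0 =
    (row j Q *m u) 0 0 + (col j (u^T *m Q)) 0 0
    - ((row i Q *m u) 0 0 + (col i (u^T *m Q)) 0 0).
  rewrite !rowM !colM -!big_split -sumrB /=.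
  by apply: eq_bigr => k _; rewrite mulrBl !mulrDl.
have entry (A B : 'M[R]_1) : (A + B) 0 0 = A 0 0 + B 0 0 by rewrite mxE.
have entryN (A : 'M[R]_1) : (- A) 0 0 = - A 0 0 by rewrite mxE.
have corner (l m : 'I_n) : (col l (row m Q)) 0 0 = Q m l by rewrite !mxE.
rewrite !(entry, entryN, corner); ring.
Qed.

Lemma quad_form_move_one (R : realType) (n : nat) (Q : 'M[R]_n) (i j : 'I_n)
    (x : binvec n) : x i 0 -> ~~ x j 0 ->
  quad_form Q (move_one i j x) = quad_form Q x
    + (\sum_(k < n | (k != i) && (k != j))
         (pair_coef Q j k - pair_coef Q i k) * (x k 0)%:R
       + pair_coef Q j j - pair_coef Q i i).
Proof.
move=> xi xj.
have ij : j != i by apply: contraNneq xj => ->.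
rewrite /quad_form real_vec_move_one // mulmx_quad_shift -addrA.
(* As $x_i = 1$ and $x_j = 0$, the indices [i] and [j] contribute only $Q_{ji} + Q_{ij} - 2 Q_{ii}$
   to the cross term; adding $d^T Q d$ leaves $Q_{jj} - Q_{ii}$. *)
congr (_ + _); rewrite (bigD1 i) //= (bigD1 j) //=.
rewrite [real_vec R x i 0]mxE [real_vec R x j 0]mxE xi (negbTE xj).
rewrite /pair_coef !eqxx mulr1 mulr0 add0r.
under [in RHS]eq_bigr => k /andP[ki kj] do rewrite !ifN_eqC //.
under eq_bigr do rewrite mxE.
ring.
Qed.

Lemma quad_form_move_one_le (R : realType) (n : nat) (Q : 'M[R]_n)
    (i j : 'I_n) (x : binvec n) : x i 0 -> ~~ x j 0 -> edge_bound Q i j <= 0 ->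
  quad_form Q (move_one i j x) <= quad_form Q x.
Proof.
move=> xi xj S_le0; rewrite quad_form_move_one // gerDl.
apply: le_trans S_le0; rewrite /edge_bound !lerD2r.
(* Termwise, $x_k = 1$ selects the second argument of the maximum and $x_k = 0$ the first. *)
apply: ler_sum => k _; rewrite le_max.
by case: (x k 0); rewrite ?mulr1 ?mulr0 lexx ?orbT.
Qed.

Theorem theorem4 (R : realType) (n : nat) (n_gt0 : (0 < n)%N)
    (E : rel 'I_n) (E_acyclic : acyclic E) (Q : 'M[R]_n)
    (S_le0 : forall i j : 'I_n, E i j -> edge_bound Q i j <= 0) :
  valid_order E (quad_form Q).
Proof.
set phi := quad_form Q; rewrite /valid_order.
have [[x0 _ x0min] min_le] := min_overP phi (in_setT (zero_binvec n)).
have [[z _ <-] ord_le] := min_overP phi (zero_binvec_ordered_by E).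
pose r k := #|[set l | connect E l k]|.
pose minimal x := phi x <= phi x0.
pose weight (x : binvec n) := (\sum_(k | x k 0%R) r k)%N.
(* The minimizer [x0] satisfies [minimal] by reflexivity, so a heaviest minimizer exists. *)
have [x x_min x_max] := @arg_maxnP _ x0 minimal weight (lexx _).
have x_ord : x \in ordered_by E.
  rewrite inE; apply/forallP => i; apply/forallP => j; apply/implyP => Eij.
  apply/implyP => xi; apply: contraT => xj.
  have moved_min : minimal (move_one i j x).
    exact: le_trans (quad_form_move_one_le xi xj (S_le0 _ _ Eij)) x_min.
  have := x_max _ moved_min; rewrite /geq /= leqNgt ltn_sum_move_one //.
  exact: acyclic_ltn_ancestors.
(* One inequality is minimization over a larger set; the other is $\phi(z) \le \phi(x) \le
   \phi(x_0)$. *)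
apply: le_anti; rewrite min_le ?in_setT //= -x0min.
exact: le_trans (ord_le _ x_ord) x_min.
Qed.
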